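(* Let $p$ be the mesh pattern $(12,R)$ with $R=\{(0,0),(0,1),(0,2),(1,0),(1,2),(2,0),(2,1)\}$, let $E(t,u)=\sum_{n\ge0}t^n\sum_{\sigma\in K_n}u^{p(\sigma)}$, and let $P(t)=\sum_{n\ge0}|K_n(p)|t^n$. Then $$P(t)=\left(\frac{1}{1+t}+\frac{t(1+t)}{1+t+tA(t)}\right)A(t),\qquad E(t,u)=\left(\frac{1}{1+t}+\frac{t(1+t)}{1+t\big(1+u+ut+(1-u)A(t)\big)}\right)A(t).$$ The initial terms of $E(t,u)$ are $1+t+2t^4+14t^5+(88+2u)t^6+(636+10u)t^7+(5174+68u)t^8+\cdots$.
   Context: A permutation $\sigma=\sigma_1\cdots\sigma_n$ of $\{1,\dots,n\}$ is a king permutation if $|\sigma_{i+1}-\sigma_i|>1$ for all $1\le i\le n-1$. $K_n$ is the set of king permutations of length $n$ ($K_0$ = the empty permutation, $K_1=\{1\}$) and $A(t)=\sum_{n\ge0}|K_n|t^n$ (known to equal $\sum_{n\ge0}n!\,t^n(1-t)^n/(1+t)^n$). For a mesh pattern $p=(12,R)$ with $R\subseteq\{0,1,2\}^2$, an occurrence of $p$ in $\sigma\in S_n$ is a pair of positions $i_1<i_2$ with $\sigma_{i_1}<\sigma_{i_2}$ such that for every $(x,y)\in R$ there is no position $m$ with $i_x<m<i_{x+1}$ and $v_y<\sigma_m<v_{y+1}$, where $i_0=0$, $i_3=n+1$, $v_0=0$, $v_1=\sigma_{i_1}$, $v_2=\sigma_{i_2}$, $v_3=n+1$ (first coordinate of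 a box indexes positions, second values). $p(\sigma)$ is the number of occurrences of $p$ in $\sigma$; $K_n(p)$ is the set of king $n$-permutations with $p(\sigma)=0$. *)

(* Defs.v *)
From HB Require Import structures.
From mathcomp Require Import all_boot all_order all_algebra all_fingroup.
From mathcomp Require Import boolp.

Set Implicit Arguments.
Unset Strict Implicit.
Unset Printing Implicit Defensive.

Import GRing.Theory.
Local Open Scope ring_scope.

(* Formal power series in one variable t; [f n] is the coefficient of t^n. *)
Record fps (R : Type) := Fps { fps_coef :> nat -> R }.

Lemma fpsP (R : Type) (f g : fps R) : (forall n, f n = g n) -> f = g.
Proof. by case: f g => [f] [g] /= fg; congr Fps; apply/funext. Qed.

HB.instance Definition _ (R : Type) := gen_eqMixin (fps R).
HB.instance Definition _ (R : Type) := gen_choiceMixin (fps R).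

Section FpsZmodule.
Variable R : zmodType.
Implicit Types f g h : fps R.

Definition fps_zero : fps R := Fps (fun=> 0).
Definition fps_opp f : fps R := Fps (fun n => - f n).
Definition fps_add f g : fps R := Fps (fun n => f n + g n).

Fact fps_addA : associative fps_add.
Proof. by move=> f g h; apply: fpsP => n /=; rewrite addrA. Qed.
Fact fps_addC : commutative fps_add.
Proof. by move=> f g; apply: fpsP => n /=; rewrite addrC. Qed.
Fact fps_add0 : left_id fps_zero fps_add.
Proof. by move=> f; apply: fpsP => n /=; rewrite add0r. Qed.
Fact fps_addN : left_inverse fps_zero fps_opp fps_add.
Proof. by move=> f; apply: fpsP => n /=; rewrite addNr. Qed.

HB.instance Definition _ :=
  GRing.isZmodule.Build (fps R) fps_addA fps_addC fps_add0 fps_addN.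

End FpsZmodule.

Section FpsRing.
Variable R : comNzRingType.
Implicit Types f g h : fps R.

Definition fpsC (c : R) : fps R := Fps (fun n => if n is 0 then c else 0).
Definition fpsX : fps R := Fps (fun n => (n == 1%N)%:R).
Definition fps_mul f g : fps R :=
  Fps (fun n => \sum_(k < n.+1) f k * g (n - k)%N).

Let trunc N f : {poly R} := \poly_(i < N) f i.

Let coef_truncM N (p q : {poly R}) f g :
  (forall i, (i < N)%N -> p`_i = f i) -> (forall i, (i < N)%N -> q`_i = g i) ->
  forall n, (n < N)%N -> (p * q)`_n = fps_mul f g n.
Proof.
move=> pf qg n nN; rewrite coefM; apply: eq_bigr => -[k /= kn] _.
by rewrite pf ?qg // (leq_ltn_trans _ nN) ?leq_subr.
Qed.

Let coef_trunc N f i : (i < N)%N -> (trunc N f)`_i = f i.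
Proof. by move=> iN; rewrite coef_poly iN. Qed.

Fact fps_mulA : associative fps_mul.
Proof.
move=> f g h; apply: fpsP => n.
have tM u v i : (i < n.+1)%N -> (trunc n.+1 u * trunc n.+1 v)`_i = fps_mul u v i.
  by apply: coef_truncM => j; apply: coef_trunc.
rewrite -(coef_truncM (@coef_trunc n.+1 f) (@tM g h)) //.
by rewrite -(coef_truncM (@tM f g) (@coef_trunc n.+1 h)) // mulrA.
Qed.

Fact fps_mulC : commutative fps_mul.
Proof.
move=> f g; apply: fpsP => n.
rewrite -(coef_truncM (@coef_trunc n.+1 f) (@coef_trunc n.+1 g)) //.
by rewrite -(coef_truncM (@coef_trunc n.+1 g) (@coef_trunc n.+1 f)) // mulrC.
Qed.

Fact fps_mul1 : left_id (fpsC 1) fps_mul.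
Proof.
move=> f; apply: fpsP => n /=; rewrite big_ord_recl /= subn0 mul1r big1 ?addr0 //.
by move=> i _; rewrite mul0r.
Qed.

Fact fps_mulDl : left_distributive fps_mul (@fps_add R).
Proof.
move=> f g h; apply: fpsP => n /=; rewrite -big_split; apply: eq_bigr => k _ /=.
by rewrite mulrDl.
Qed.

Fact fps_oner_neq0 : fpsC 1 != 0.
Proof.
apply/eqP => /(congr1 (fun f : fps R => f 0%N)) /= /eqP.
by rewrite (oner_eq0 R).
Qed.

HB.instance Definition _ := GRing.Zmodule_isComNzRing.Build (fps R)
  fps_mulA fps_mulC fps_mul1 fps_mulDl fps_oner_neq0.

End FpsRing.

Arguments fpsX {R}.

Section FpsUnitRing.
Variable R : comUnitRingType.
Implicit Types f g : fps R.

Definition fps_unit : pred (fps R) := fun f => f 0%N \is a GRing.unit.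

(* [fps_inv_upto f n] lists the first n coefficients of 1/f. *)
Fixpoint fps_inv_upto f (n : nat) : seq R :=
  if n is n'.+1 then
    let s := fps_inv_upto f n' in
    rcons s ((f 0%N)^-1 * ((n' == 0)%:R - \sum_(k < n') f (n' - k)%N * s`_k))
  else [::].

Definition fps_inv f : fps R :=
  if fps_unit f then Fps (fun n => (fps_inv_upto f n.+1)`_n) else f.

Let size_inv_upto f n : size (fps_inv_upto f n) = n.
Proof. by elim: n => //= n IHn; rewrite size_rcons IHn. Qed.

Let nth_inv_upto f n k :
  (k < n)%N -> (fps_inv_upto f n)`_k = (fps_inv_upto f k.+1)`_k.
Proof.
elim: n => // n IHn; rewrite ltnS leq_eqVlt => /orP[/eqP-> //|kn].
by rewrite [LHS]/= nth_rcons size_inv_upto kn IHn.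
Qed.

Fact fps_mulVf : {in fps_unit, left_inverse 1 fps_inv *%R}.
Proof.
move=> f uf; rewrite mulrC; apply: fpsP => n.
have {}uf : fps_unit f by [].
have -> : (f * fps_inv f) n = \sum_(k < n.+1) fps_inv f k * f (n - k)%N.
  by rewrite mulrC.
rewrite /fps_inv uf big_ord_recr /= subnn nth_rcons size_inv_upto ltnn eqxx.
rewrite mulrAC mulVr // mul1r [X in _ + (_ - X)](_ : _ =
  \sum_(k < n) (fps_inv_upto f k.+1)`_k * f (n - k)%N); last first.
  by apply: eq_bigr => k _; rewrite mulrC nth_inv_upto.
by rewrite addrC subrK; case: n.
Qed.

Fact fps_unitPl f g : g * f = 1 -> fps_unit f.
Proof.
move=> /(congr1 (fun h : fps R => h 0%N)) /=.
rewrite big_ord_recl big_ord0 addr0 subn0 => gf1.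
by apply/unitrPr; exists (g 0%N); rewrite mulrC.
Qed.

Fact fps_inv_out : {in [predC fps_unit], fps_inv =1 id}.
Proof. by move=> f /negbTE fN; rewrite /fps_inv ifF. Qed.

HB.instance Definition _ := GRing.ComNzRing_hasMulInverse.Build (fps R)
  fps_mulVf fps_unitPl fps_inv_out.

End FpsUnitRing.

(* Permutations of {1, ..., n} are represented as permutations of
   'I_n = {0, ..., n-1}: the i-th position (value) has index i.-1. *)

Definition king n (s : 'S_n) : bool :=
  [forall i : 'I_n, forall j : 'I_n,
    (j == i.+1 :> nat) ==> (1 < `|(s j)%:Z - (s i)%:Z|)].

Definition kings n : {set 'S_n} := [set s | king s].

Definition grid n (a b : 'I_n) (k : nat) : nat :=
  nth 0%N [:: 0; a.+1; b.+1; n.+1]%N k.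

(* Occurrence of the mesh pattern (12, R) at positions i, j; in a box
   (x, y) of R the first coordinate indexes positions, the second values. *)
Definition mesh12_occ (R : {set 'I_3 * 'I_3}) n (s : 'S_n) (i j : 'I_n) : bool :=
  [&& (i < j)%N, (s i < s j)%N &
    [forall b in R, ~~ [exists m : 'I_n,
      (grid i j b.1 < m.+1 < grid i j b.1.+1)%N &&
      (grid (s i) (s j) b.2 < (s m).+1 < grid (s i) (s j) b.2.+1)%N]]].

Definition mesh12_count (R : {set 'I_3 * 'I_3}) n (s : 'S_n) : nat :=
  #|[set ij : 'I_n * 'I_n | mesh12_occ R s ij.1 ij.2]|.

Definition kings_avoiding (R : {set 'I_3 * 'I_3}) n : {set 'S_n} :=
  [set s in kings n | mesh12_count R s == 0%N].

Definition king_gf (K : comNzRingType) : fps K := Fps (fun n => #|kings n|%:R).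

Definition avoid_gf (R : {set 'I_3 * 'I_3}) : fps int :=
  Fps (fun n => #|kings_avoiding R n|%:R).

(* Bivariate generating functions live in Z[u][[t]], with u = 'X. *)
Definition dist_gf (R : {set 'I_3 * 'I_3}) : fps {poly int} :=
  Fps (fun n => \sum_(s in kings n) 'X^(mesh12_count R s)).

Definition shading : {set 'I_3 * 'I_3} :=
  [set b : 'I_3 * 'I_3 | (val b.1, val b.2) \in
    [:: (0, 0); (0, 1); (0, 2); (1, 0); (1, 2); (2, 0); (2, 1)]%N].

(* Main.v *)
Require Import Defs.
From mathcomp Require Import all_boot all_order all_algebra all_fingroup.
From mathcomp Require Import zify ring.

Import GRing.Theory.

Set Implicit Arguments.
Unset Strict Implicit.
Unset Printing Implicit Defensive.

(**
Call [j] a strong fixed point of a permutation when the entries before it are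
smaller and those after it are larger.  The shading leaves only the boxes (1,1)
and (2,2) free, so an occurrence consists of a minimum in first position and of
a strong fixed point in a later position.  Let B count the king permutations
without strong fixed point, S(u) all of them with weight u per strong fixed
point, and F(u) those starting with their minimum, with weight u per further
strong fixed point.  Cutting at the first strong fixed point gives
S(u) = B (1 + u F(u)); deleting an initial minimum gives
F(u) = t (S(u) - u F(u)).  Since S(1) = A and E = A - F(1) + F(u), eliminating B
and S(u) yields the formula for E, and P is its value at u = 0.
*)

(** * Words, direct sums and strong fixed points *)

Definition words n : seq (seq nat) := permutations (iota 0 n).

Definition far (x y : nat) : bool := ((x.+1 < y) || (y.+1 < x))%N.

(* For a duplicate-free word: smaller entries before [k], larger ones after. *)
Definition strong_fix (w : seq nat) (k : nat) : bool :=
  all (fun i => (nth 0 w i < nth 0 w k) == (i < k))%N (iota 0 (size w)).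

Definition strong_count (w : seq nat) : nat :=
  count (strong_fix w) (iota 0 (size w)).

(** The direct sum of permutations: [r] is placed to the right of [a] and, when [a] is a word on the
    values below its length, above it. *)
Definition dsum (a r : seq nat) : seq nat := a ++ map (addn (size a)) r.

Lemma wordsP n w : (w \in words n) = perm_eq w (iota 0 n).
Proof. exact: mem_permutations. Qed.

Lemma size_words n w : w \in words n -> size w = n.
Proof. by rewrite wordsP => /perm_size; rewrite size_iota. Qed.

Lemma nth_words n w i : w \in words n -> (i < n)%N -> (nth 0 w i < n)%N.
Proof.
move=> wn lt_in; have /(mem_nth 0) : (i < size w)%N by rewrite (size_words wn).
by move: wn; rewrite wordsP => /perm_mem ->; rewrite mem_iota.
Qed.

Lemma strong_fixP w k :
  reflect (forall i, (i < size w)%N -> (nth 0 w i < nth 0 w k)%N = (i < k)%N)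
          (strong_fix w k).
Proof.
apply: (iffP allP) => [H i lt_i|H i]; first by apply: (eqP (H i _)); rewrite mem_iota.
by rewrite mem_iota => /andP[_ lt_i]; rewrite H.
Qed.

Lemma dsum_words k m a r :
  a \in words k -> (dsum a r \in words (k + m)) = (r \in words m).
Proof.
move=> ak; rewrite !wordsP /dsum (size_words ak) iotaD add0n.
move: ak; rewrite wordsP => ak.
have -> : iota k m = map (addn k) (iota 0 m) by rewrite -iotaDl addn0.
rewrite (perm_catr (map (addn k) r) ak) perm_cat2l.
apply/idP/idP; last exact: perm_map.
by apply: perm_map_inj; apply: addnI.
Qed.

(** The prefix uses up the values below [k], so the suffix consists of the values from [k] on, and
    lowering it by [k] gives [r]. *)
Lemma words_dsumP k m a b :
  a \in words k -> a ++ b \in words (k + m) ->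
  exists2 r, r \in words m & a ++ b = dsum a r.
Proof.
move=> ak abkm.
have bk : perm_eq b (iota k m).
  move: ak abkm; rewrite !wordsP iotaD add0n => ak.
  by rewrite (perm_catr b ak) perm_cat2l.
have Eab : a ++ b = dsum a (map (subn^~ k) b).
  congr (_ ++ _); rewrite -map_comp (size_words ak) -[LHS]map_id.
  apply/eq_in_map => x; rewrite (perm_mem bk) mem_iota /=; lia.
exists (map (subn^~ k) b) => //.
by rewrite -(dsum_words m _ ak) -Eab.
Qed.

Lemma size_dsum a r : size (dsum a r) = (size a + size r)%N.
Proof. by rewrite size_cat size_map. Qed.

Lemma nth_dsum a r i : (i < size a + size r)%N ->
  nth 0 (dsum a r) i =
  if (i < size a)%N then nth 0 a i else (size a + nth 0 r (i - size a))%N.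
Proof.
move=> lt_i; rewrite nth_cat; case: ltnP => // le_i.
by rewrite (nth_map 0) //; lia.
Qed.

Lemma nth_dsumr a r i : i < size r ->
  nth 0 (dsum a r) (size a + i) = size a + nth 0 r i.
Proof.
by move=> lt_i; rewrite nth_dsum ?ltn_add2l // ifN ?addKn // -leqNgt leq_addr.
Qed.

(** The shifted entries of [r] come after all of [a] and exceed all of it, so they always pass the
    test at a position of [a]. *)
Lemma strong_fix_dsuml k a r i :
  a \in words k -> (i < k)%N -> strong_fix (dsum a r) i = strong_fix a i.
Proof.
move=> ak lt_i; have sa := size_words ak.
apply/strong_fixP/strong_fixP; rewrite size_dsum sa => H j lt_j.
  by have := H j; rewrite !nth_dsum sa ?lt_j ?lt_i; [apply|..]; lia.
rewrite !nth_dsum ?sa ?lt_i; try lia.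
case: (ltnP j k) => le_j; first by rewrite H.
have := nth_words ak lt_i; lia.
Qed.

Lemma strong_fix_dsumr k m a r i :
    a \in words k -> r \in words m -> (i < m)%N ->
  strong_fix (dsum a r) (k + i) = strong_fix r i.
Proof.
move=> ak rm lt_i; have sa := size_words ak; have sr := size_words rm.
have Ei : nth 0 (dsum a r) (k + i) = (k + nth 0 r i)%N.
  by rewrite -sa nth_dsumr ?sr.
apply/strong_fixP/strong_fixP; rewrite size_dsum sa sr Ei => H j lt_j.
  have := H (k + j); rewrite (_ : nth 0 (dsum a r) (k + j) = k + nth 0 r j).
    by rewrite !ltn_add2l; apply.
  by rewrite -sa nth_dsumr ?sr.
rewrite nth_dsum ?sa ?sr //; case: (ltnP j k) => le_j.
  have := nth_words ak le_j; lia.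
rewrite ltn_add2l H; lia.
Qed.

Lemma has_strong_fix_dsuml k a r : a \in words k ->
  has (strong_fix (dsum a r)) (iota 0 k) = has (strong_fix a) (iota 0 k).
Proof.
move=> ak; apply: eq_in_has => i; rewrite mem_iota => /andP[_ lt_i].
exact: strong_fix_dsuml ak lt_i.
Qed.

Lemma strong_count_dsum k m a r : a \in words k -> r \in words m ->
  strong_count (dsum a r) = (strong_count a + strong_count r)%N.
Proof.
move=> ak rm; rewrite /strong_count size_dsum (size_words ak) (size_words rm).
rewrite iotaD count_cat add0n -[X in iota X m]addn0 iotaDl count_map.
congr (_ + _)%N; apply: eq_in_count => i; rewrite mem_iota => /andP[_ lt_i].
  exact: strong_fix_dsuml ak lt_i.
exact: strong_fix_dsumr ak rm lt_i.
Qed.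

(** * The king condition on direct sums *)

Lemma far_add k x y : far (k + x) (k + y) = far x y.
Proof. rewrite /far; lia. Qed.

Lemma sorted_far_shift k r : sorted far (map (addn k) r) = sorted far r.
Proof. by rewrite sorted_map; apply: eq_sorted => x y /=; rewrite far_add. Qed.

Lemma sorted_cat_far (a : seq nat) (b : seq nat) : a != [::] -> b != [::] ->
  sorted far (a ++ b) =
    [&& sorted far a, far (last 0%N a) (head 0%N b) & sorted far b].
Proof. by case: a b => [|x a] [|y b] //= _ _; rewrite cat_path. Qed.

(* The last entry of a nonempty word without strong fixed point is not its
   maximum, so it is never adjacent in value to the minimum of the next summand. *)
Lemma sorted_far_dsum k m a r :
    a \in words k -> r \in words m -> ~~ has (strong_fix a) (iota 0 k) ->
    head 0%N r == 0%N ->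
  sorted far (dsum a r) = sorted far a && sorted far r.
Proof.
move=> ak rm nofix r0; have sa := size_words ak.
have [->|a_n0] := eqVneq a [::]; first by rewrite /dsum /= sorted_far_shift.
have [->|r_n0] := eqVneq r [::]; first by rewrite /dsum cats0 andbT.
rewrite sorted_cat_far //; last by case: (r) r_n0.
rewrite sorted_far_shift sa; congr (_ && _).
suff -> : far (last 0%N a) (head 0%N (map (addn k) r)) by [].
have -> : head 0%N (map (addn k) r) = k.
  by case: (r) r_n0 r0 => //= x s _ /eqP->; rewrite addn0.
have k_gt0 : (0 < k)%N by rewrite -sa; case: (a) a_n0.
have lt_k : (k.-1 < k)%N by rewrite prednK.
have El : last 0%N a = nth 0 a k.-1 by rewrite -sa nth_last.
have := nth_words ak lt_k; rewrite -El leq_eqVlt => /orP[/eqP Elk|]; last first.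
  by rewrite /far => ->.
case/negP: nofix; apply/hasP; exists k.-1; first by rewrite mem_iota.
apply/strong_fixP => i; rewrite sa => lt_i.
have [->|ne_i] := eqVneq i k.-1; first by rewrite -El !ltnn.
have := nth_words ak lt_i; rewrite -El.
have ua : uniq a by move: ak; rewrite wordsP => /perm_uniq->; apply: iota_uniq.
have : nth 0 a i != nth 0 a k.-1 by rewrite nth_uniq ?sa.
by rewrite -El; move: ne_i => /eqP ne_i /eqP; lia.
Qed.

(** * Cutting a word at its first strong fixed point *)

Lemma strong_fix_take n w k : w \in words n -> (k < n)%N -> strong_fix w k ->
  take k w \in words k.
Proof.
move=> wn lt_k /strong_fixP; rewrite (size_words wn) => fk.
set x := nth 0 w k in fk *.
have sw := size_words wn; have le_k := ltnW lt_k.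
(* The entries before position [k] are exactly those below [x], hence a rearrangement of [iota 0 x];
   comparing lengths then gives [x = k]. *)
have Ef : filter (fun y => (y < x)%N) w = take k w.
  rewrite -{1}(cat_take_drop k w) filter_cat.
  rewrite (_ : filter _ (drop k w) = [::]) ?cats0.
    apply/all_filterP/(all_nthP 0%N) => i; rewrite size_takel ?sw // => lt_i.
    by rewrite nth_take // fk // (ltn_trans lt_i).
  apply/eqP; rewrite -(negbK (_ == _)) -has_filter -all_predC.
  apply/(all_nthP 0%N) => i; rewrite size_drop sw => lt_i /=.
  by rewrite nth_drop fk; lia.
have := wn; rewrite wordsP => /(perm_filter (fun y => (y < x)%N)).
rewrite Ef (@filter_iota_ltn 0 n x); last exact/ltnW/nth_words.
move=> Ep; rewrite wordsP; have := perm_size Ep.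
by rewrite size_takel ?size_iota ?sw // => Ek; rewrite [X in iota 0 X]Ek.
Qed.

(** The entry 0 occurs somewhere; anywhere but in front it would be a later entry below the first
    one. *)
Lemma strong_fix0 w : (0 < size w)%N -> uniq w -> 0%N \in w ->
  strong_fix w 0 = (head 1%N w == 0%N).
Proof.
case: w => // x w _ uw w0 /=; apply/strong_fixP/eqP => [H|-> i _]; last by [].
by have := H (index 0%N (x :: w)); rewrite index_mem nth_index //= => /(_ w0); lia.
Qed.

Lemma strong_fix0_words n w : w \in words n.+1 ->
  strong_fix w 0 = (head 1%N w == 0%N).
Proof.
move=> wn; have sw := size_words wn; move: wn; rewrite wordsP => wn.
apply: strong_fix0; rewrite ?sw //; first by rewrite (perm_uniq wn) iota_uniq.
by rewrite (perm_mem wn) mem_iota.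
Qed.

(** By the convention of [find], this is [size w] when there is no strong fixed point. *)
Definition first_fix (w : seq nat) : nat := find (strong_fix w) (iota 0 (size w)).

(* [head 0 r == 0] holds for the empty word too, whereas [head 1 w == 0] does
   not; [k = n] is thus the case without strong fixed point. *)
Lemma first_fix_split n k : k <= n ->
  perm_eq [seq w <- words n | sorted far w && (first_fix w == k)]
    [seq dsum a r
      | a <- [seq a <- words k | sorted far a && ~~ has (strong_fix a) (iota 0 k)],
        r <- [seq r <- words (n - k) | sorted far r && (head 0%N r == 0%N)]].
Proof.
move=> le_k; have En : n = (k + (n - k))%N by rewrite subnKC.
apply: uniq_perm; first exact/filter_uniq/permutations_uniq.
  apply: allpairs_uniq; [exact/filter_uniq/permutations_uniq.. |].
  case=> a r [a' r'] /allpairsP[[? ?] /= [ak _ [-> ->]]].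
  case/allpairsP=> [[? ?] /= [a'k _ [-> ->]]] /eqP.
  move: ak a'k; rewrite !mem_filter => /andP[_ /size_words sa] /andP[_ /size_words sa'].
  rewrite eqseq_cat sa ?sa' // => /andP[/eqP-> /eqP/inj_map->] //.
  exact: addnI.
move=> w; apply/idP/allpairsP.
  rewrite mem_filter => /andP[/andP[kw /eqP fw] wn].
  (* For [k < n] the position [k] is strongly fixed, so the prefix is a word; for [k = n] the prefix
     is all of [w]. *)
  have ak : take k w \in words k.
    have [lt_k|] := ltnP k n; last first.
      by move=> le_n; rewrite take_oversize ?(size_words wn) // (_ : k = n) //; lia.
    apply: (strong_fix_take wn lt_k).
    have fh : has (strong_fix w) (iota 0 (size w)).
      by rewrite has_find size_iota -/(first_fix w) fw (size_words wn).
    have := nth_find 0%N fh; rewrite -/(first_fix w) fw nth_iota //.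
    by rewrite (size_words wn).
  have [|r rm Ew] := @words_dsumP k (n - k) _ (drop k w) ak.
    by rewrite cat_take_drop -En.
  rewrite cat_take_drop in Ew.
  have nofix : ~~ has (strong_fix (take k w)) (iota 0 k).
    rewrite -(has_strong_fix_dsuml r ak) -Ew; apply/hasPn => i.
    rewrite mem_iota => /andP[_ lt_i]; apply/negbT.
    have := @before_find _ 0 (strong_fix w) (iota 0 (size w)) i.
    rewrite -/(first_fix w) fw nth_iota; first exact.
    by rewrite (size_words wn) (leq_trans lt_i).
  have r0 : head 0%N r == 0%N.
    (* Either [r] is empty and the default of [head] decides, or the strong fixed point at [k]
       becomes one of [r] at 0, which forces [r] to start with 0. *)
    have [lt_k|] := posnP (n - k); first by have := size_words rm; rewrite lt_k; case: (r).
    case Em: (n - k)%N rm => [//|m] rm _.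
    have := strong_fix_dsumr ak rm (ltn0Sn m); rewrite -Ew addn0.
    have fh : has (strong_fix w) (iota 0 (size w)).
      by rewrite has_find size_iota -/(first_fix w) fw (size_words wn); lia.
    have := nth_find 0%N fh; rewrite -/(first_fix w) fw nth_iota ?(size_words wn); last by lia.
    rewrite add0n => -> /esym; rewrite (strong_fix0_words rm).
    by have := size_words rm; case: (r).
  exists (take k w, r); split => //=; rewrite mem_filter ?ak ?rm ?nofix ?r0 !andbT.
    by move: kw; rewrite {1}Ew (sorted_far_dsum ak rm) // => /andP[].
  by move: kw; rewrite {1}Ew (sorted_far_dsum ak rm) // => /andP[].
case=> -[a r] /= []; rewrite !mem_filter => /andP[/andP[ka nofix] ak].
case/andP=> /andP[kr r0] rm ->; rewrite [in words n]En dsum_words // rm andbT.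
rewrite (sorted_far_dsum ak rm) // ka kr /=.
rewrite /first_fix size_dsum (size_words ak) (size_words rm) iotaD find_cat.
rewrite (has_strong_fix_dsuml r ak) (negbTE nofix) size_iota add0n.
case: (n - k)%N rm => [|m] rm /=; first by rewrite addn0.
rewrite -{2}[k]addn0 (strong_fix_dsumr ak rm) // (strong_fix0_words rm).
by have := size_words rm; case: (r) r0 => //= x s /eqP->; rewrite addn0 eqxx.
Qed.

(** * Deleting an initial minimum *)

Lemma dsum1_words n w : (dsum [:: 0] w \in words n.+1) = (w \in words n).
Proof. by rewrite -add1n dsum_words. Qed.

(** The only new neighbours are 0 and the shifted first entry of [w], too close exactly when that
    entry was 0. The default 1 lets the empty word pass. *)
Lemma sorted_far_dsum1 w :
  sorted far (dsum [:: 0] w) = sorted far w && (head 1 w != 0).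
Proof.
case: w => // x w; rewrite /dsum [LHS]/= -[path _ _ _]/(sorted far (map (addn 1) (x :: w))).
by rewrite sorted_far_shift andbC /far add1n; case: x.
Qed.

Lemma strong_count_dsum1 n w :
  w \in words n -> strong_count (dsum [:: 0] w) = (strong_count w).+1.
Proof. exact: (@strong_count_dsum 1 n [:: 0]). Qed.

Lemma head0_split n :
  perm_eq [seq w <- words n.+1 | sorted far w && (head 1 w == 0)]
    [seq dsum [:: 0] w | w <- [seq w <- words n | sorted far w && (head 1 w != 0)]].
Proof.
apply: uniq_perm; first exact/filter_uniq/permutations_uniq.
  rewrite map_inj_uniq; first exact/filter_uniq/permutations_uniq.
  by move=> w w' [] /inj_map; apply; apply: addnI.
move=> w; apply/idP/mapP.
  rewrite mem_filter => /andP[/andP[kw w0] wn].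
  have Ew : w = [:: 0] ++ behead w.
    by have := size_words wn; case: (w) w0 => //= x s /eqP->.
  have [|r rn Er] := @words_dsumP 1 n [:: 0] (behead w) isT.
    by rewrite -Ew.
  rewrite -Ew in Er; exists r => //.
  by rewrite mem_filter rn andbT -sorted_far_dsum1 -Er.
case=> r; rewrite mem_filter -sorted_far_dsum1 => /andP[kr rn] ->.
by rewrite mem_filter kr dsum1_words.
Qed.

Lemma strong_count_gt0 n w :
  w \in words n -> head 1 w == 0 -> 0 < strong_count w.
Proof.
case: n => [|n] wn w0; first by move: (size_words wn) w0; case: w wn.
rewrite /strong_count (size_words wn) -has_count /=.
by rewrite (strong_fix0_words wn) w0.
Qed.

Local Open Scope ring_scope.

(** * Generating series of words and their two functional equations *)

Section Series.
Variables (K : comNzRingType) (u : K).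

(** [strong_gf], [free_gf] and [head_gf] are the series S(u), B and F(u) of the overview. *)
Definition strong_gf : fps K :=
  Fps (fun n => \sum_(w <- words n | sorted far w) u ^+ strong_count w).

Definition free_gf : fps K :=
  Fps (fun n => \sum_(w <- words n |
                      sorted far w && ~~ has (strong_fix w) (iota 0 n)) 1).

(** The predecessor discards the initial minimum, which is itself a strong fixed point. *)
Definition head_gf : fps K :=
  Fps (fun n => \sum_(w <- words n | sorted far w && (head 1 w == 0)%N)
                  u ^+ (strong_count w).-1).

Lemma coef_fpsD (f g : fps K) n : (f + g) n = f n + g n.
Proof. by []. Qed.

Lemma coef_fpsB (f g : fps K) n : (f - g) n = f n - g n.
Proof. by []. Qed.

Lemma coef_fps1 n : (1 : fps K) n = (n == 0%N)%:R.
Proof. by case: n. Qed.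

Lemma coef_fpsM (f g : fps K) n : (f * g) n = \sum_(k < n.+1) f k * g (n - k)%N.
Proof. by []. Qed.

Lemma coef_fpsCM (c : K) (f : fps K) n : (fpsC c * f) n = c * f n.
Proof.
rewrite [LHS]/= big_ord_recl subn0 big1 ?addr0 // => i _.
by rewrite mul0r.
Qed.

Lemma coef_fpsXM (f : fps K) n : (fpsX * f) n = if n is m.+1 then f m else 0.
Proof.
case: n => [|n]; rewrite [LHS]/= big_ord_recl mul0r add0r ?big_ord0 //.
rewrite big_ord_recl mul1r big1 ?addr0; first by rewrite subSS subn0.
by move=> i _; rewrite mul0r.
Qed.

Lemma coef_head0 n : (1 + fpsC u * head_gf) n =
  \sum_(w <- words n | sorted far w && (head 0 w == 0)%N) u ^+ strong_count w.
Proof.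
rewrite coef_fpsD coef_fpsCM coef_fps1; case: n => [|n] /=.
  by rewrite !big_cons !big_nil /= mulr0 !addr0.
rewrite add0r big_distrr; rewrite big_seq_cond [RHS]big_seq_cond.
apply: eq_big => w.
  by case wn: (w \in _) => //=; have := size_words wn; case: (w).
case/andP=> wn /andP[_ w0].
by rewrite /= -exprS prednK // (strong_count_gt0 wn).
Qed.

Lemma strong_gfE : strong_gf = free_gf * (1 + fpsC u * head_gf).
Proof.
apply: fpsP => n.
rewrite [LHS]/= big_seq_cond.
(* The position of the first strong fixed point is at most [n], so it can serve as the summation
   index of the Cauchy product. *)
pose ff w := inord (first_fix w) : 'I_n.+1.
rewrite (partition_big ff predT) // coef_fpsM; apply: eq_bigr => k _.
have le_k : (k <= n)%N by rewrite -ltnS.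
rewrite coef_head0.
transitivity (\sum_(w <- [seq w <- words n | sorted far w && (first_fix w == k)])
    u ^+ strong_count w).
  rewrite big_filter [RHS]big_seq_cond; apply: eq_bigl => w.
  case wn: (w \in _) => //=; congr (_ && _); apply/eqP/eqP => [<-|Ek].
    rewrite inordK // ltnS -(size_words wn) /first_fix.
    by apply: leq_trans (find_size _ _) _; rewrite size_iota.
  by apply: val_inj; rewrite /= inordK Ek // ltnS.
rewrite (perm_big _ (first_fix_split le_k)) /= big_allpairs_dep /=.
rewrite big_distrl /= big_filter.
rewrite big_seq_cond [RHS]big_seq_cond; apply: eq_bigr => a /andP[ak /andP[_ nofix]].
rewrite mul1r big_filter big_seq_cond [RHS]big_seq_cond; apply: eq_bigr => r.
case/andP=> rm _; rewrite (strong_count_dsum ak rm); congr (u ^+ _).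
rewrite /strong_count (size_words ak); move: nofix; rewrite has_count.
by rewrite -leqNgt leqn0 => /eqP->.
Qed.

Lemma head_gfE : head_gf = fpsX * (strong_gf - fpsC u * head_gf).
Proof.
apply: fpsP => n; rewrite coef_fpsXM; case: n => [|n].
  by rewrite /= big_cons big_nil.
rewrite [LHS]/= -big_filter (perm_big _ (head0_split n)) big_map big_filter.
rewrite coef_fpsB coef_fpsCM /=.
(* The words of S(u) that start with 0 are exactly what the subtracted [u * F(u)] cancels. *)
rewrite [X in _ = X - _](bigID (fun w => head 1 w == 0)%N) /= addrAC big_distrr /=.
rewrite [X in X - _ + _](_ : _ = \sum_(w <- words n | sorted far w && (head 1 w == 0)%N)
    u * u ^+ (strong_count w).-1).
  rewrite subrr add0r big_seq_cond [RHS]big_seq_cond.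
  by apply: eq_bigr => w /andP[wn _]; rewrite (strong_count_dsum1 wn).
rewrite big_seq_cond [RHS]big_seq_cond; apply: eq_bigr => w /and3P[wn _ w0].
by rewrite /= -exprS prednK // (strong_count_gt0 wn).
Qed.

End Series.

(** * Passing from permutations to words *)

Section Words.
Variable n : nat.
Implicit Types s : 'S_n.

Definition word_of s : seq nat := [seq val (s i) | i <- enum 'I_n].

Lemma size_word_of s : size (word_of s) = n.
Proof. by rewrite size_map size_enum_ord. Qed.

Lemma nth_word_of s (i : 'I_n) : nth 0%N (word_of s) i = s i.
Proof. by rewrite (nth_map i) ?size_enum_ord // nth_ord_enum. Qed.

Lemma word_of_words s : word_of s \in words n.
Proof.
rewrite wordsP /word_of map_comp -val_enum_ord; apply: perm_map.
apply: uniq_perm; last 1 first.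
- move=> i; rewrite mem_enum; apply/mapP; exists ((s^-1)%g i).
    by rewrite mem_enum.
  by rewrite permKV.
- by rewrite map_inj_uniq ?enum_uniq //; apply: perm_inj.
- exact: enum_uniq.
Qed.

Lemma word_of_inj : injective word_of.
Proof.
move=> s s' Es; apply/permP => i; apply: val_inj.
by rewrite /= -!nth_word_of Es.
Qed.

Lemma perm_words : perm_eq [seq word_of s | s <- enum 'S_n] (words n).
Proof.
have us : uniq [seq word_of s | s <- enum 'S_n].
  by rewrite map_inj_uniq ?enum_uniq //; apply: word_of_inj.
(* An injection between two collections of size n! is onto. *)
have [||_ Em] := uniq_min_size (s2 := words n) us.
- by move=> _ /mapP[s _ ->]; apply: word_of_words.
- rewrite size_map -cardE size_permutations ?iota_uniq // size_iota.
  have := card_perm [set: 'I_n]; rewrite cardsT card_ord => <-.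
  apply: subset_leq_card; apply/subsetP => s _ /=.
  by rewrite inE.
by apply: uniq_perm => //; apply: permutations_uniq.
Qed.

Lemma king_word s : king s = sorted far (word_of s).
Proof.
have farE (a b : nat) : (1 < `|b%:Z - a%:Z|) = far a b by rewrite /far; lia.
apply/'forall_forallP/(sortedP 0%N).
  rewrite size_word_of => H i lt_i; have lt_i' := ltnW lt_i.
  have := H (Ordinal lt_i') (Ordinal lt_i); rewrite eqxx /= farE.
  by rewrite -!nth_word_of.
move=> H i j; apply/implyP => /eqP Ej; rewrite farE -!nth_word_of Ej; apply: H.
by rewrite size_word_of -Ej.
Qed.

Lemma sum_words (R : nmodType) (P : pred (seq nat)) (F : seq nat -> R) :
  \sum_(w <- words n | P w) F w = \sum_(s : 'S_n | P (word_of s)) F (word_of s).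
Proof.
rewrite -(perm_big _ perm_words) big_map big_enum_cond.
by apply: eq_bigl => s; rewrite inE.
Qed.

End Words.

(** * Occurrences of the mesh pattern as strong fixed points *)

Lemma strong_fix_wordP n (s : 'S_n) (j : 'I_n) :
  reflect (forall m : 'I_n, (s m < s j)%N = (m < j)%N)
          (strong_fix (word_of s) j).
Proof.
apply: (iffP (strong_fixP _ _)); rewrite size_word_of => H m.
  by rewrite -!nth_word_of H.
by move=> lt_m; rewrite -(H (Ordinal lt_m)) -!nth_word_of.
Qed.

(* Boxes of column 0 and row 0 force the lower point to be the first entry
   and the minimum; boxes (1, 2) and (2, 1) make the upper one strongly fixed. *)
Lemma mesh12_occ_shading n (s : 'S_n) (i j : 'I_n) :
  mesh12_occ shading s i j =
  [&& i == 0%N :> nat, s i == 0%N :> nat, (0 < j)%N & strong_fix (word_of s) j].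
Proof.
have inj (a b : 'I_n) : s a = s b :> nat -> a = b :> nat.
  by move=> /val_inj/perm_inj ->.
apply/and3P/and4P => [[lt_ij lt_sij /forallP H]|[/eqP i0 /eqP si0 j_gt0]].
  have box x y (hx : (x < 3)%N) (hy : (y < 3)%N) :
      (x, y) \in [:: (0, 0); (0, 1); (0, 2); (1, 0); (1, 2); (2, 0); (2, 1)]%N ->
    forall m : 'I_n, ~~ ((grid i j x < m.+1 < grid i j x.+1)%N &&
      (grid (s i) (s j) y < (s m).+1 < grid (s i) (s j) y.+1)%N).
    move=> xyR m; have /implyP := H (Ordinal hx, Ordinal hy).
    by rewrite inE => /(_ xyR) /existsPn/(_ m).
  have {H}B00 := @box 0%N 0%N isT isT isT; have B01 := @box 0%N 1%N isT isT isT.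
  have B02 := @box 0%N 2%N isT isT isT; have B10 := @box 1%N 0%N isT isT isT.
  have B12 := @box 1%N 2%N isT isT isT; have B20 := @box 2%N 0%N isT isT isT.
  have {box}B21 := @box 2%N 1%N isT isT isT; rewrite /grid /= in B00 B01 B02 B10 B12 B20 B21.
  have n_gt0 : (0 < n)%N by apply: leq_ltn_trans (ltn_ord i).
  have i0 : nat_of_ord i = 0%N.
    (* If [i] were not the first position, the first entry would lie in column 0, whose three boxes
       are all shaded. *)
    pose m := Ordinal n_gt0; have Em : nat_of_ord m = 0%N by [].
    have := inj m i; have := inj m j; have := ltn_ord (s m).
    move: (B00 m) (B01 m) (B02 m); rewrite Em; lia.
  have si0 : nat_of_ord (s i) = 0%N.
    (* The position of the minimum: unless it is [i], it lies in row 0, whose three boxes are all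
       shaded. *)
    pose m := (s^-1)%g (Ordinal n_gt0).
    have Em : nat_of_ord (s m) = 0%N by rewrite permKV.
    have [<- //|mi] := eqVneq m i.
    have [Ej|mj] := eqVneq m j; first by move: lt_sij; rewrite -Ej Em.
    have vmi : nat_of_ord m <> i by move/val_inj/eqP; apply/negP.
    have vmj : nat_of_ord m <> j by move/val_inj/eqP; apply/negP.
    have := ltn_ord m; move: (B00 m) (B10 m) (B20 m); rewrite Em; lia.
  split; rewrite ?i0 ?si0 //; first by lia.
  apply/strong_fix_wordP => m; have [->|mj] := eqVneq m j; first by rewrite !ltnn.
  have [->|mi] := eqVneq m i; first by rewrite lt_sij lt_ij.
  have smi : nat_of_ord (s m) <> s i by move/val_inj/perm_inj/eqP; apply/negP.
  have smj : nat_of_ord (s m) <> s j by move/val_inj/perm_inj/eqP; apply/negP.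
  have vmi : nat_of_ord m <> i by move/val_inj/eqP; apply/negP.
  have vmj : nat_of_ord m <> j by move/val_inj/eqP; apply/negP.
  have := ltn_ord m; have := ltn_ord (s m); move: (B12 m) (B21 m); lia.
move=> /strong_fix_wordP fj; have := fj i; rewrite i0 j_gt0 => lt_sij.
split => //.
apply/forallP => -[[x hx] [y hy]]; apply/implyP; rewrite inE => xyR.
apply/existsPn => m; have := fj m; move: xyR; rewrite !inE /grid.
have := ltn_ord m; have := ltn_ord (s m).
rewrite /= => ? ?; do ?[case/orP => [/eqP[-> ->]|]]; last move/eqP=> [-> ->].
all: rewrite /= ?i0 ?si0; lia.
Qed.

Lemma card_ord_iota n (P : pred nat) : #|[set i : 'I_n | P i]| = count P (iota 0 n).
Proof.
by rewrite cardsE -val_enum_ord count_map cardE enumT /enum_mem size_filter.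
Qed.

Lemma mesh12_count_word n (s : 'S_n) :
  mesh12_count shading s =
  if (head 1 (word_of s) == 0)%N then (strong_count (word_of s)).-1 else 0%N.
Proof.
case: n s => [|n] s.
  have -> : word_of s = [::] by apply/size0nil/size_word_of.
  by apply/eqP; rewrite cards_eq0; apply/eqP/setP => -[[]].
have sw := size_word_of s; have wn := word_of_words s.
have hw : head 1%N (word_of s) = s ord0.
  by rewrite -nth_word_of; case: (word_of s) sw.
case: eqP => [w0|w0]; last first.
  apply/eqP; rewrite cards_eq0; apply/eqP/setP => -[i j]; rewrite !inE /=.
  rewrite mesh12_occ_shading; apply/negbTE/negP => /and3P[/eqP i0 /eqP si0 _].
  by case: w0; rewrite hw -si0; congr (val (s _)); apply: val_inj.
rewrite /strong_count sw /= (strong_fix0_words wn) w0 eqxx add1n /=.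
have -> : count (strong_fix (word_of s)) (iota 1 n) =
    count (fun j => (0 < j)%N && strong_fix (word_of s) j) (iota 0 n.+1).
  by rewrite /= add0n; apply: eq_in_count => j; rewrite mem_iota => /andP[->].
have pair_inj : injective (fun j : 'I_n.+1 => (ord0 : 'I_n.+1, j)) by move=> j j' [].
(* The lower point of an occurrence is always position 0, so occurrences are counted by their upper
   point alone. *)
rewrite -card_ord_iota -(card_imset _ pair_inj).
apply: eq_card => -[i j]; rewrite !inE mesh12_occ_shading /=.
apply/and4P/imsetP => [[/eqP i0 _ j_gt0 fj]|[j' + [-> ->]]].
  by exists j; rewrite ?inE ?j_gt0 //; congr pair; apply: val_inj.
by rewrite inE => /andP[-> ->]; rewrite -hw w0.
Qed.

(** * The distribution series and its closed form *)

(** The weight [u] lives in an arbitrary ring, so that E is the instance ['X] and P the instance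
    0. *)
Definition mesh_gf (K : comNzRingType) (u : K) : fps K :=
  Fps (fun n => \sum_(s in kings n) u ^+ mesh12_count shading s).

Lemma king_gfE (K : comNzRingType) : king_gf K = strong_gf 1.
Proof.
apply: fpsP => n /=; rewrite sum_words -sum1_card natr_sum.
by apply: eq_big => s; rewrite ?inE ?king_word // expr1n.
Qed.

(** Kings not starting with their minimum have no occurrence and contribute A - F(1); the others
    contribute F(u). *)
Lemma mesh_gfE (K : comNzRingType) (u : K) :
  mesh_gf u = king_gf K - head_gf 1 + head_gf u.
Proof.
rewrite king_gfE; apply: fpsP => n; rewrite coef_fpsD coef_fpsB /= !sum_words.
rewrite (bigID (fun s => head 1 (word_of s) == 0)%N) /= addrC; congr (_ + _).
  rewrite [X in _ = X - _](bigID (fun s => head 1 (word_of s) == 0)%N) /=.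
  rewrite addrAC [X in _ = X - _ + _](eq_bigr (fun=> 1)); last first.
    by move=> s _; rewrite expr1n.
  rewrite [X in _ = _ - X + _](eq_bigr (fun=> 1)); last first.
    by move=> s _; rewrite expr1n.
  rewrite subrr add0r; apply: eq_big => s; first by rewrite inE king_word.
  by case/andP=> _ /negbTE; rewrite mesh12_count_word expr1n => ->.
apply: eq_big => s; first by rewrite inE king_word.
by case/andP=> _; rewrite mesh12_count_word => ->.
Qed.

Lemma fps_unit1 (K : comUnitRingType) (f : fps K) :
  f 0%N = 1 -> f \is a GRing.unit.
Proof. by move=> f0; rewrite unfold_in /= /fps_unit f0 unitr1. Qed.

(* Eliminating [strong_gf u] and [free_gf] from the two decompositions. *)
Lemma head_gf_closed (K : comNzRingType) (u : K) (t := fpsX : fps K)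
    (A := king_gf K) (U := fpsC u) :
  head_gf u * (1 + t * (1 + U + U * t + (1 - U) * A)) = t * (1 + t) * A.
Proof.
have H1 := head_gfE (1 : K); rewrite -king_gfE -/A mul1r -/t in H1.
have S1 := strong_gfE (1 : K); rewrite -king_gfE -/A mul1r in S1.
have Hu := head_gfE u; have Su := strong_gfE u; rewrite -/t -/U in Hu Su.
rewrite {}Su in Hu; set F1 := head_gf 1 in H1 S1; set F := head_gf u in Hu *.
set B := free_gf K in S1 Hu.
have tF1 : (1 + t) * F1 = t * A by rewrite {1}mulrDl mul1r {1}H1; ring.
have BA : B * (1 + t + t * A) = A * (1 + t).
  by rewrite -tF1 [in RHS]S1; ring.
have FB : F * (1 + U * t - U * t * B) = t * B.
  rewrite mulrBr mulrDr mulr1 {1}Hu; ring.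
(* Multiplying [FB] by [1 + t + t * A] lets [BA] replace [B] on both sides without any division. *)
transitivity (F * (1 + U * t - U * t * B) * (1 + t + t * A)).
  transitivity (F * ((1 + U * t) * (1 + t + t * A) - U * t * (B * (1 + t + t * A)))).
    by rewrite BA; ring.
  by ring.
by rewrite FB -mulrA BA; ring.
Qed.

Lemma mesh_gf_closed (K : comUnitRingType) (u : K) (t := fpsX : fps K)
    (A := king_gf K) (U := fpsC u) :
  mesh_gf u =
  ((1 + t)^-1 + t * (1 + t) / (1 + t * (1 + U + U * t + (1 - U) * A))) * A.
Proof.
have H1 := head_gfE (1 : K); rewrite -king_gfE -/A mul1r -/t in H1.
have HF := head_gf_closed u; rewrite /= -/t -/A -/U in HF.
set D := 1 + t * _ in HF *.
have uD : D \is a GRing.unit.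
  by apply: fps_unit1; rewrite coef_fpsD coef_fpsXM addr0.
have uT : 1 + t \is a GRing.unit.
  by apply: fps_unit1; rewrite coef_fpsD addr0.
rewrite mulrDl; set F1 := head_gf 1 in H1.
have EF : head_gf u = t * (1 + t) / D * A by rewrite mulrAC -HF mulrK.
(* From F(1) = t (A - F(1)): multiplied by [1 + t], the left side becomes [A]. *)
have EA : A - F1 = (1 + t)^-1 * A.
  apply: (mulrI uT); rewrite mulVKr // mulrBr {1}mulrDl mul1r.
  by rewrite [X in _ - X]mulrDl mul1r {1}H1; ring.
by rewrite mesh_gfE EF -EA.
Qed.

(** * Initial coefficients *)

Local Open Scope nat_scope.

(** Counts the orderings of [s] that may follow [x], with [m] the length of [s] as fuel. Branches
    are pruned at the first close pair, which keeps the count computable. *)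
Fixpoint king_ext (m x : nat) (s : seq nat) : nat :=
  if m is m'.+1 then
    sumn [seq if far x y then king_ext m' y (rem y s) else 0 | y <- s]
  else 1.

Lemma king_extE m x (s : seq nat) : uniq s -> size s = m ->
  king_ext m x s = count (path far x) (permutations s).
Proof.
elim: m x s => [|m IHm] x s us sm; first by rewrite (size0nil sm).
have s_gt0 : 0 < size s by rewrite sm.
rewrite (seq.permP (permutationsE s_gt0)) undup_id // count_flatten -map_comp /=.
congr sumn; apply/eq_in_map => y ys /=; rewrite count_map.
case: ifP => xy; last by rewrite (eq_count (a2 := pred0)) ?count_pred0 // => w /=; rewrite xy.
rewrite IHm ?rem_uniq ?size_rem ?sm //.
by apply: eq_count => w /=; rewrite xy.
Qed.

(** The starting letter [n.+1] is far from every letter below [n], so it imposes no condition; [n]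
    would exclude a first letter [n.-1]. *)
Lemma card_kings n : #|kings n| = king_ext n n.+1 (iota 0 n).
Proof.
rewrite king_extE ?iota_uniq ?size_iota // -sum1_count.
rewrite -sum1_card -/(words n) [RHS]big_seq_cond.
rewrite [RHS](eq_bigl (fun w => (w \in words n) && sorted far w)).
  by rewrite -big_seq_cond sum_words; apply: eq_bigl => s; rewrite inE king_word.
move=> w; case wn: (w \in words n) => //=.
case: w wn => //= x w wn; rewrite andb_idl // => _.
by have := nth_words (i := 0) wn; rewrite -(size_words wn) /= /far; lia.
Qed.

Lemma card_kings_upto8 :
  [seq #|kings n| | n <- iota 0 9] = [:: 1; 1; 0; 0; 2; 14; 90; 646; 5242].
Proof.
rewrite (eq_map card_kings).
by vm_compute.
Qed.

Local Open Scope ring_scope.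

(** Here [a], [h], [b], [f] stand for the coefficients of A, F(1), B, F(u). The recurrences
    determine [h], then [b], then [f] from [a]; the sums stop before [n] because F has no constant
    term. *)
Lemma mesh_coef_upto8 (K : comNzRingType) (u : K) (a h b f : nat -> K) :
    [seq a n | n <- iota 0 9] = [:: 1; 1; 0; 0; 2; 14; 90; 646; 5242] ->
    h 0%N = 0 -> (forall n, h n.+1 = a n - h n) ->
    (forall n, a n = b n + \sum_(k < n) b k * h (n - k)%N) ->
    f 0%N = 0 ->
    (forall n, f n.+1 =
       b n + \sum_(k < n) b k * (u * f (n - k)%N) - u * f n) ->
  [seq a n - h n + f n | n <- iota 0 9]
    = [:: 1; 1; 0; 0; 2%:R; 14%:R; 88%:R + 2%:R * u;
          636%:R + 10%:R * u; 5174%:R + 68%:R * u].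
Proof.
case=> a0 a1 a2 a3 a4 a5 a6 a7 a8 h0 hS aE f0 fS.
have bN n : b n = a n - \sum_(k < n) b k * h (n - k)%N by rewrite aE addrK.
have h1 : h 1 = 1 by rewrite hS a0 h0; ring.
have h2 : h 2 = 0 by rewrite hS a1 h1; ring.
have h3 : h 3 = 0 by rewrite hS a2 h2; ring.
have h4 : h 4 = 0 by rewrite hS a3 h3; ring.
have h5 : h 5 = 2%:R by rewrite hS a4 h4; ring.
have h6 : h 6 = 12%:R by rewrite hS a5 h5; ring.
have h7 : h 7 = 78%:R by rewrite hS a6 h6; ring.
have h8 : h 8 = 568%:R by rewrite hS a7 h7; ring.
have hE := (h1, h2, h3, h4, h5, h6, h7, h8).
have b0 : b 0 = 1 by rewrite bN big_ord0 a0 subr0.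
have b1 : b 1 = 0.
  by rewrite bN !big_ord_recl big_ord0 /= ?(a1, hE, b0); ring.
have b2 : b 2 = 0.
  by rewrite bN !big_ord_recl big_ord0 /= ?(a2, hE, b0, b1); ring.
have b3 : b 3 = 0.
  by rewrite bN !big_ord_recl big_ord0 /= ?(a3, hE, b0, b1, b2); ring.
have b4 : b 4 = 2%:R.
  by rewrite bN !big_ord_recl big_ord0 /= ?(a4, hE, b0, b1, b2, b3); ring.
have b5 : b 5 = 10%:R.
  by rewrite bN !big_ord_recl big_ord0 /= ?(a5, hE, b0, b1, b2, b3, b4); ring.
have b6 : b 6 = 68%:R.
  by rewrite bN !big_ord_recl big_ord0 /= ?(a6, hE, b0, b1, b2, b3, b4, b5); ring.
have b7 : b 7 = 500%:R.
  by rewrite bN !big_ord_recl big_ord0 /= ?(a7, hE, b0, b1, b2, b3, b4, b5, b6); ring.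
have bE := (b0, b1, b2, b3, b4, b5, b6, b7).
have f1 : f 1 = 1.
  by rewrite fS big_ord0 /= ?(bE, f0); ring.
have f2 : f 2 = 0.
  by rewrite fS !big_ord_recl big_ord0 /= ?(bE, f0, f1); ring.
have f3 : f 3 = 0.
  by rewrite fS !big_ord_recl big_ord0 /= ?(bE, f0, f1, f2); ring.
have f4 : f 4 = 0.
  by rewrite fS !big_ord_recl big_ord0 /= ?(bE, f0, f1, f2, f3); ring.
have f5 : f 5 = 2%:R.
  by rewrite fS !big_ord_recl big_ord0 /= ?(bE, f0, f1, f2, f3, f4); ring.
have f6 : f 6 = 10%:R + 2%:R * u.
  by rewrite fS !big_ord_recl big_ord0 /= ?(bE, f0, f1, f2, f3, f4, f5); ring.
have f7 : f 7 = 68%:R + 10%:R * u.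
  by rewrite fS !big_ord_recl big_ord0 /= ?(bE, f0, f1, f2, f3, f4, f5, f6); ring.
have f8 : f 8 = 500%:R + 68%:R * u.
  by rewrite fS !big_ord_recl big_ord0 /= ?(bE, f0, f1, f2, f3, f4, f5, f6, f7); ring.
(* Generalizing 5174 keeps the large numeral away from [ring]; the last entry then only needs 68 -
   568 + 500 = 0. *)
have E5242 : 5242 = 5174%:R + 68%:R :> K by rewrite -natrD.
rewrite /= !(h0, a0, a1, a2, a3, a4, a5, a6, a7, a8, hE) E5242; move: 5174%:R => c.
rewrite !(f0, f1, f2, f3, f4, f5, f6, f7, f8).
by congr [:: _; _; _; _; _; _; _; _; _]; ring.
Qed.

Lemma mesh_gf_upto8 (K : comNzRingType) (u : K) :
  [seq mesh_gf u n | n <- iota 0 9]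
    = [:: 1; 1; 0; 0; 2%:R; 14%:R; 88%:R + 2%:R * u;
          636%:R + 10%:R * u; 5174%:R + 68%:R * u].
Proof.
have H0 v : head_gf v 0 = 0 :> K by rewrite head_gfE coef_fpsXM.
have S v n : strong_gf v n =
    free_gf K n + \sum_(k < n) free_gf K k * (v * head_gf v (n - k)%N) :> K.
  rewrite {1}strong_gfE mulrDr mulr1 coef_fpsD coef_fpsM; congr (_ + _).
  under eq_bigr do rewrite coef_fpsCM.
  rewrite big_ord_recr (_ : (n - ord_max)%N = 0%N) ?subnn // H0 !mulr0.
  exact: addr0.
rewrite -(@mesh_coef_upto8 K u (king_gf K) (head_gf 1) (free_gf K) (head_gf u)) //.
- by rewrite mesh_gfE.
- rewrite -[LHS]/(map (fun n => n%:R) (map (fun n => #|kings n|) (iota 0 9))).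
  by rewrite card_kings_upto8.
- by move=> n; rewrite {1}head_gfE coef_fpsXM -king_gfE coef_fpsB coef_fpsCM mul1r.
- move=> n; rewrite king_gfE S; congr (_ + _).
  by apply: eq_bigr => k _; rewrite mul1r.
- by move=> n; rewrite {1}head_gfE coef_fpsXM coef_fpsB coef_fpsCM S.
Qed.

(** At [u = 0] the weight is 1 for no occurrence, as [0 ^+ 0 = 1], and 0 otherwise. *)
Lemma avoid_gfE : avoid_gf shading = mesh_gf (0 : int).
Proof.
apply: fpsP => n /=; rewrite -sum1_card natr_sum.
rewrite [LHS]big_mkcond [RHS]big_mkcond.
apply: eq_bigr => s _; rewrite inE expr0n.
by case: (s \in kings n) => //=; case: eqP.
Qed.

Theorem theorem4p2 :
  [/\ (let t : fps int := fpsX in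
       let A : fps int := king_gf int in
       avoid_gf shading
         = ((1 + t)^-1 + t * (1 + t) / (1 + t + t * A)) * A),
      (let t : fps {poly int} := fpsX in
       let u : fps {poly int} := fpsC 'X in
       let A : fps {poly int} := king_gf {poly int} in
       dist_gf shading
         = ((1 + t)^-1
            + t * (1 + t) / (1 + t * (1 + u + u * t + (1 - u) * A))) * A)
    & [seq dist_gf shading n | n <- iota 0 9]
        = [:: 1; 1; 0; 0; 2%:R; 14%:R; 88%:R + 2%:R * 'X;
              636%:R + 10%:R * 'X; 5174%:R + 68%:R * 'X] :> seq {poly int}].
Proof.
split=> /=; last exact: mesh_gf_upto8.
  have U0 : fpsC (0 : int) = 0 by apply: fpsP => -[].
  rewrite avoid_gfE mesh_gf_closed U0; congr ((_ + _ / _) * _).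
  by rewrite mul0r subr0 !addr0; ring.
exact: mesh_gf_closed.
Qed.
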